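(* The system $\mathtt{HDI}$ is sound with respect to topic-sensitive models: for every formula $\phi\in\mathcal{L}_{I^{d},G}$, if $\vdash_{\mathtt{HDI}}\phi$, then $\mathcal{M}\models\phi$ for every topic-sensitive model $\mathcal{M}$.
   Context: Language. Let $\mathtt{Prop}$ be a set of propositional variables. $\mathcal{L}_{I^{d},G}$ is given by $\phi:=p\mid\neg\phi\mid\phi\wedge\phi\mid I^{d}\phi\mid G\phi\mid\Box\phi$ with $p\in\mathtt{Prop}$; $\vee,\rightarrow,\leftrightarrow$ are defined classically. $Var(\phi)$ is the set of variables occurring in $\phi$. Models. A topic model is $\mathcal{T}=(T,\oplus,t,\mathfrak{K})$ with $T$ a non-empty set, $\oplus:T\times T\to T$ idempotent, commutative and associative, $\mathfrak{K}\in T$, and $t:\mathtt{Prop}\to T$. Extend $t$ to formulas by $t(\phi)=\oplus\{t(p):p\in Var(\phi)\}$, and put $a\sqsubseteq b$ iff $a\oplus b=b$. A topic-sensitive model is $\mathcal{M}=(W,R,v,\mathcal{T})$ with $W\neq\emptyset$, $R\subseteq W\times W$ arbitrary, $v:\mathtt{Prop}\to\mathcal{P}(W)$, and $\mathcal{T}$ a topic model. Truth: $\mathcal{M},w\models p$ iff $w\in v(p)$; $\neg,\wedge$ classical; $\mathcal{M},w\models\Box\phi$ iff $\mathcal{M},w'\models\phi$ for all $w'\in W$; $\mathcal{M},w\models G\phi$ iff $t(\phi)\sqsubseteq\mathfrak{K}$; $\mathcal{M},w\models I^{d}\phi$ iff $t(\phi)\sqsubseteq\mathfrak{K}$ and $\mathcal{M},w\models\phi$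 and for all $w'\neq w$, if $Rww'$ then $\mathcal{M},w'\models\neg\phi$. $\mathcal{M}\models\phi$ means $\mathcal{M},w\models\phi$ for all $w\in W$. System $\mathtt{HDI}$ (axiom schemas and rules): all classical propositional tautologies and Modus Ponens; all S5 axioms and rules for $\Box$; (G1) $G\phi\leftrightarrow G\neg\phi$; (G2) $G\phi\leftrightarrow GI^{d}\phi$; (G3) $G\phi\leftrightarrow G\Box\phi$; (G4) $(G\phi\wedge G\psi)\leftrightarrow G(\phi\wedge\psi)$; (G5) $G\phi\rightarrow\Box G\phi$; (HIR) from $\vdash\phi\rightarrow\psi$ infer $\vdash\phi\rightarrow(I^{d}\psi\rightarrow(G\phi\rightarrow I^{d}\phi))$; (A1) $I^{d}\phi\rightarrow\phi$; (A2) $(I^{d}\phi\wedge I^{d}\psi)\rightarrow I^{d}(\phi\vee\psi)$; (A3) $I^{d}\phi\rightarrow G\phi$. *)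

(* Defs.v *)
From mathcomp Require Import all_boot all_order.
From mathcomp Require Import finmap.
From mathcomp Require Import boolp classical_sets.

Set Implicit Arguments.
Unset Strict Implicit.
Unset Printing Implicit Defensive.

(* [V] is the set Prop of propositional variables: an arbitrary type. *)
Inductive form (V : Type) : Type :=
| Atom of V
| Neg of form V
| And of form V & form V
| Idk of form V
| Grasp of form V
| Box of form V.

Definition Or (V : Type) (f g : form V) : form V := Neg (And (Neg f) (Neg g)).
Definition Imp (V : Type) (f g : form V) : form V := Neg (And f (Neg g)).
Definition Iff (V : Type) (f g : form V) : form V := And (Imp f g) (Imp g f).

(* [{classic V}] is [V] itself with classical decidable equality and choice,
   which finite sets over it require. *)
Fixpoint Var (V : Type) (f : form V) : {fset {classic V}} :=
  match f with
  | Atom p => fset1 (p : {classic V})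
  | Neg g => Var g
  | And g h => fsetU (Var g) (Var h)
  | Idk g => Var g
  | Grasp g => Var g
  | Box g => Var g
  end.

(* The field [background] is the distinguished topic K (Fraktur); it also
   witnesses that [topic] is non-empty. *)
Record topic_model (V : Type) : Type := TopicModel {
  topic : Type;
  fusion : topic -> topic -> topic;
  fusionxx : idempotent_op fusion;
  fusionC : commutative fusion;
  fusionA : associative fusion;
  topic_of : V -> topic;
  background : topic }.

(* [oAC] adjoins the unit [None] to [fusion], so that the sum over a finite set
   is defined even when the set is empty. *)
Definition otopic (V : Type) (T : topic_model V) (f : form V) :
    option (topic T) :=
  \big[oAC (@fusionA V T) (@fusionC V T)/None]_(p <- Var f)
    Some (topic_of T p).

(* The default value is never used: see [topic_formE]. *)
Definition topic_form (V : Type) (T : topic_model V) (f : form V) : topic T :=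
  odflt (background T) (otopic T f).

Lemma Var_neq0 (V : Type) (f : form V) : Var f != fset0.
Proof.
elim: f => //= [p|f IHf g _]; first by apply/fset0Pn; exists p; rewrite fset11.
by rewrite fsetU_eq0 negb_and IHf.
Qed.

Lemma topic_formE (V : Type) (T : topic_model V) (f : form V) :
  Some (topic_form T f) = otopic T f.
Proof.
rewrite /topic_form; suff: otopic T f <> None by case: (otopic T f).
have : (Var f : seq _) != [::].
  apply/negP => /eqP Vf0; have /fset0Pn[p] := Var_neq0 f.
  by have -> : (p \in Var f) = (p \in (Var f : seq _)) by []; rewrite Vf0.
rewrite /otopic; case: (Var f : seq _) => // p s _; rewrite big_cons.
by case: (bigop _ _ _).
Qed.

Definition topic_le (V : Type) (T : topic_model V) (a b : topic T) : Prop :=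
  fusion a b = b.

Record model (V : Type) : Type := Model {
  world : Type;
  world_inh : inhabited world;
  rel_acc : world -> world -> Prop;
  val_at : V -> set world;
  topics : topic_model V }.

Fixpoint sat (V : Type) (M : model V) (w : world M) (f : form V) : Prop :=
  match f with
  | Atom p => val_at p w
  | Neg g => ~ sat w g
  | And g h => sat w g /\ sat w h
  | Idk g =>
      [/\ topic_le (topic_form (topics M) g) (background (topics M)),
          sat w g
        & forall w' : world M, w' <> w -> rel_acc w w' -> ~ sat w' g]
  | Grasp g => topic_le (topic_form (topics M) g) (background (topics M))
  | Box g => forall w' : world M, sat w' g
  end.

Definition valid_in (V : Type) (M : model V) (f : form V) : Prop :=
  forall w : world M, sat w f.

(* Truth-functional evaluation: variables and formulas whose main operator is
   modal are read as atoms, valued by [e]. *)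
Fixpoint beval (V : Type) (e : form V -> bool) (f : form V) : bool :=
  match f with
  | Neg g => ~~ beval e g
  | And g h => beval e g && beval e h
  | Atom _ | Idk _ | Grasp _ | Box _ => e f
  end.

Definition tautology (V : Type) (f : form V) : Prop :=
  forall e : form V -> bool, beval e f = true.

Inductive HDI (V : Type) : form V -> Prop :=
| HDI_taut f : tautology f -> HDI f
| HDI_MP f g : HDI (Imp f g) -> HDI f -> HDI g
| HDI_K f g : HDI (Imp (Box (Imp f g)) (Imp (Box f) (Box g)))
| HDI_T f : HDI (Imp (Box f) f)
| HDI_4 f : HDI (Imp (Box f) (Box (Box f)))
| HDI_5 f : HDI (Imp (Neg (Box f)) (Box (Neg (Box f))))
| HDI_Nec f : HDI f -> HDI (Box f)
| HDI_G1 f : HDI (Iff (Grasp f) (Grasp (Neg f)))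
| HDI_G2 f : HDI (Iff (Grasp f) (Grasp (Idk f)))
| HDI_G3 f : HDI (Iff (Grasp f) (Grasp (Box f)))
| HDI_G4 f g : HDI (Iff (And (Grasp f) (Grasp g)) (Grasp (And f g)))
| HDI_G5 f : HDI (Imp (Grasp f) (Box (Grasp f)))
| HDI_HIR f g :
    HDI (Imp f g) -> HDI (Imp f (Imp (Idk g) (Imp (Grasp f) (Idk f))))
| HDI_A1 f : HDI (Imp (Idk f) f)
| HDI_A2 f g : HDI (Imp (And (Idk f) (Idk g)) (Idk (Or f g)))
| HDI_A3 f : HDI (Imp (Idk f) (Grasp f)).

(* Main.v *)
Require Import Defs.
From mathcomp Require Import all_boot finmap boolp.

(** The fusion order makes [fusion] a join, so [t(f) <= a] holds iff [t(p) <= a]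
    for every variable [p] of [f]; the axioms (G1)-(G4) and (A2) thereby reduce to
    identities between variable sets. Rule (HIR) is applied at the inaccessible
    worlds by contraposition: [f -> g] is valid, so [f] fails wherever [g] does. *)

Lemma topic_le_fusion (V : Type) (T : topic_model V) (a b c : topic T) :
  topic_le (fusion a b) c <-> topic_le a c /\ topic_le b c.
Proof.
rewrite /topic_le; split=> [abc | [ac bc]]; last by rewrite -fusionA bc.
(* Expanding [c] as [fusion (fusion a b) c] lets idempotence absorb the extra copy of [a] or [b]. *)
split; rewrite -[in LHS]abc; first by rewrite !fusionA fusionxx.
by rewrite [fusion a b]fusionC !fusionA fusionxx [fusion b a]fusionC.
Qed.

Lemma topic_le_form (V : Type) (T : topic_model V) (f : form V) (a : topic T) :
  topic_le (topic_form T f) a <->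
  forall p : {classic V}, p \in Var f -> topic_le (topic_of T p) a.
Proof.
(* The induction runs over arbitrary lists; the empty sum [None] counts as lying below every
   topic. *)
have Vars (s : seq {classic V}) :
    (if \big[oAC (@fusionA V T) (@fusionC V T)/None]_(p <- s) Some (topic_of T p)
     is Some b then topic_le b a else True) <->
    forall p, p \in s -> topic_le (topic_of T p) a.
  elim: s => [|p s IHs]; first by rewrite big_nil.
  have -> : (forall q, q \in p :: s -> topic_le (topic_of T q) a) <->
      topic_le (topic_of T p) a /\
      (forall q, q \in s -> topic_le (topic_of T q) a).
    split=> [ps_a | [pa s_a] q]; last by rewrite inE => /predU1P[-> //|/s_a].
    by split=> [|q sq]; apply: ps_a; rewrite inE ?eqxx // sq orbT.
  rewrite -IHs big_cons; case: (bigop _ _ _) => [b|] /=; last by tauto.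
  exact: topic_le_fusion.
(* The sum over [Var f] is a [Some], so the [True] branch disappears. *)
by have := Vars (Var f); rewrite -/(otopic T f) -topic_formE.
Qed.

Lemma topic_le_eq_Var (V : Type) (T : topic_model V) (f g : form V)
    (a : topic T) :
  Var f = Var g -> topic_le (topic_form T f) a <-> topic_le (topic_form T g) a.
Proof. by move=> fg; rewrite !topic_le_form fg. Qed.

Lemma topic_le_And (V : Type) (T : topic_model V) (f g : form V) (a : topic T) :
  topic_le (topic_form T (And f g)) a <->
  topic_le (topic_form T f) a /\ topic_le (topic_form T g) a.
Proof.
rewrite !topic_le_form /=; split=> [fg_a | [fa ga] p].
  by split=> p pV; apply: fg_a; rewrite in_fsetU pV ?orbT.
by rewrite in_fsetU => /orP[/fa|/ga].
Qed.

Lemma sat_Imp (V : Type) (M : model V) (w : world M) (f g : form V) :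
  sat w (Imp f g) <-> (sat w f -> sat w g).
Proof.
split=> /= [fg fw | fg [/fg gw]]; last by apply.
by apply: contrapT => ngw; apply: fg.
Qed.

Lemma sat_Iff (V : Type) (M : model V) (w : world M) (f g : form V) :
  sat w (Iff f g) <-> (sat w f <-> sat w g).
Proof.
have -> : sat w (Iff f g) <-> sat w (Imp f g) /\ sat w (Imp g f) by [].
by rewrite !sat_Imp.
Qed.

Lemma sat_Or (V : Type) (M : model V) (w : world M) (f g : form V) :
  sat w (Or f g) <-> sat w f \/ sat w g.
Proof. by rewrite /= -not_orP; split=> [/contrapT|fg /(_ fg)]. Qed.

(** Truth at a fixed world is a Boolean valuation of atoms and modal formulas, so tautologies hold
    at every world. *)
Lemma sat_beval (V : Type) (M : model V) (w : world M) (f : form V) :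
  sat w f <-> beval (fun g => `[< sat w g >]) f.
Proof.
elim: f => [p|f IHf|f IHf g IHg|f _|f _|f _] /=;
  try exact: (rwP (asboolP _)).
  by rewrite IHf; exact: (rwP negP).
by rewrite IHf IHg; exact: (rwP andP).
Qed.

Theorem theorem5 (V : Type) (f : form V) :
  HDI f -> forall M : model V, valid_in M f.
Proof.
move=> prov M.
elim: prov => {f} [f tf|f g _ fg _ fV|f g|f|f|f|f _ fV|f|f|f|f g|f|f g _ fg
                  |f|f g|f] w.
- by apply/sat_beval; rewrite tf.
- by move/sat_Imp: (fg w); apply; apply: fV.
- rewrite !sat_Imp => fg fV w'; move/sat_Imp: (fg w'); apply; exact: fV.
- by rewrite sat_Imp; apply.
(* The truth of [Box f] does not depend on the world, which gives axioms 4 and 5; likewise [Grasp f]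
   for (G5). *)
- by rewrite sat_Imp => fV w'.
- by rewrite sat_Imp => nfV w'.
- exact: fV.
(* [Neg], [Idk] and [Box] leave [Var] unchanged by computation. *)
- by rewrite sat_Iff; apply: topic_le_eq_Var.
- by rewrite sat_Iff; apply: topic_le_eq_Var.
- by rewrite sat_Iff; apply: topic_le_eq_Var.
- by rewrite sat_Iff /= topic_le_And.
- by rewrite sat_Imp => fK w'.
- rewrite !sat_Imp => fw [_ _ ng] fK; split=> // w' w'w Rw' fw'.
  by apply: (ng w') => //; move/sat_Imp: (fg w'); apply.
- by rewrite sat_Imp => -[].
- rewrite sat_Imp => -[[fK fw nf] [gK _ ng]]; split.
  (* [Or f g] has the same variables as [And f g], so the criterion for conjunctions applies. *)
  + rewrite -(topic_le_eq_Var _ _ (And f g) (Or f g)) //.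
    exact/topic_le_And.
  + by apply/sat_Or; left.
  + by move=> w' w'w Rw' /sat_Or[]; [apply: nf | apply: ng].
- by rewrite sat_Imp => -[].
Qed.
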